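(* Let $G$ be a bipartite graph with $n$ vertices, $m$ edges and diameter three, with partite sets $V_1,V_2$ where $|V_1|=n_1$ and $|V_2|=n_2$ (so $n=n_1+n_2$). Let $\lambda_{\max}$ be the largest eigenvalue of the Laplacian matrix of $G$. Then $$Mo(G)\leq \sqrt{m}\sqrt{\frac{\lambda_{\max}}{n}\left(n_{1}n_{2}n^{2}-4mn^{2}+4M_{1}(G)n-4n_{1}^{2}n_{2}^{2}-16m^{2}+16n_{1}n_{2}m\right)}.$$
   Context: All graphs are finite, simple and undirected; $d(x,y)$ is the graph distance and $\deg(v)$ the degree. The Laplacian matrix $L$ has $L_{ii}=\deg(i)$, $L_{ij}=-1$ if $ij$ is an edge and $0$ otherwise. For an edge $e=(u,v)$, $n_e(u)$ is the number of vertices $w$ with $d(w,u)<d(w,v)$. The Mostar index is $Mo(G)=\sum_{e=(u,v)\in E(G)}|n_e(u)-n_e(v)|$. The first Zagreb index is $M_1(G)=\sum_{v\in V(G)}\deg(v)^2$. *)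

(* Defs.v *)
From HB Require Import structures.
From mathcomp Require Import all_boot all_order all_algebra.

Set Implicit Arguments.
Unset Strict Implicit.
Unset Printing Implicit Defensive.

Import Order.TTheory GRing.Theory Num.Theory.

Record sgraph := SGraph {
  vertex :> finType;
  adj : rel vertex;
  adj_sym : symmetric adj;
  adj_irr : irreflexive adj }.

Section Graph.

Variable G : sgraph.
Implicit Types (u v w x y : G).

Definition deg v : nat := #|[set w | adj v w]|.

(* Each unordered edge is represented by exactly one of its two orientations,
   the one that increases along the enumeration of the vertices. *)
Definition edges : {set G * G} :=
  [set p : G * G | adj p.1 p.2 & (enum_rank p.1 < enum_rank p.2)%N].

Definition walk_length k x y : bool :=
  [exists p : k.-tuple G, path (@adj G) x p && (last x p == y)].

(* Least length of a walk from x to y. Shortest walks have length < #|G|, so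
   the search is exhaustive; it returns #|G| exactly when y is unreachable. *)
Definition dist x y : nat :=
  find (fun k => walk_length k x y) (iota 0 #|G|).

Definition connected : Prop := forall x y, connect (@adj G) x y.

(* Only meaningful for connected graphs, because of the default value taken by
   dist on unreachable pairs. *)
Definition diameter : nat := \max_(x : G) \max_(y : G) dist x y.

Definition bipartition (V1 V2 : {set G}) : Prop :=
  [/\ V1 :|: V2 = [set: G], [disjoint V1 & V2] &
      forall x y, adj x y ->
        (x \in V1) && (y \in V2) || (x \in V2) && (y \in V1)].

(* n_e(u) for the edge e = (u, v). *)
Definition closer u v : nat := #|[set w | (dist w u < dist w v)%N]|.

(* `|a - b|%N is the absolute difference, not truncated subtraction. The summand
   is symmetric, so the choice of orientation in edges is immaterial. *)
Definition mostar : nat :=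
  (\sum_(p in edges) `|closer p.1 p.2 - closer p.2 p.1|)%N.

Definition zagreb1 : nat := (\sum_(v : G) deg v ^ 2)%N.

Local Open Scope ring_scope.

Definition laplacian (R : nzRingType) : 'M[R]_#|G| :=
  \matrix_(i, j)
    (if i == j then (deg (enum_val i))%:R
     else if adj (enum_val i) (enum_val j) then -1 else 0).

End Graph.

Local Open Scope ring_scope.

Definition largest_eigenvalue (R : realFieldType) (n : nat) (A : 'M[R]_n)
    (a : R) : Prop :=
  eigenvalue A a /\ forall b, eigenvalue A b -> b <= a.

(* Main.v *)
(* Give a vertex w the weight f w = 2 deg w + |V(w)|, where V(w) is the part
   containing w. In a bipartite graph of diameter at most three the distance
   from w to the ends of an edge uv is determined by parity, equality and
   adjacency, so n_e(u) - n_e(v) = f u - f v. By Cauchy-Schwarz Mo(G)^2 is at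
   most m times the Laplacian quadratic form at f, which does not change when f
   is centered; the Rayleigh bound on the orthogonal complement of the constants
   then gives lambda_max (sum f^2 - (sum f)^2 / n), and summing over the vertices
   evaluates this in terms of n1, n2, m and M_1. *)
Require Import Defs.
From HB Require Import structures.
From mathcomp Require Import all_boot all_order all_algebra.
From mathcomp Require Import spectral complex ring lra.

Set Implicit Arguments.
Unset Strict Implicit.
Unset Printing Implicit Defensive.

Import Order.TTheory GRing.Theory Num.Theory.
Local Open Scope ring_scope.

(** * The Rayleigh bound for real symmetric matrices *)

Section Rayleigh.
Local Open Scope sesquilinear_scope.

(** The spectral theorem is applied over the complex extension of [R], where [A] becomes hermitian.
    Its eigenvalues [d] are real, hence eigenvalues of [A] and at most [a], and the form is diagonal
    in the coordinates [y]. *)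
Lemma rayleigh_le (R : rcfType) n (A : 'M[R]_n) (a : R) (x : 'rV[R]_n) :
  A^T = A -> (forall b, eigenvalue A b -> b <= a) ->
  (x *m A *m x^T) 0 0 <= a * (x *m x^T) 0 0.
Proof.
move=> symA lea; pose toC := real_complex R.
pose B := map_mx toC A; pose P := spectralmx B; pose d := spectral_diag B.
have toCreal (r : R) : toC r \is Num.real by apply/complex_realP; exists r.
have symB : B \is symmetricmx.
  by apply/is_hermitianmxP; rewrite expr0 scale1r map_mx_id // /B map_trmx symA.
have realB : B \is a realmx by apply/mxOverP=> i j; rewrite mxE.
have /orthomx_spectralP defB := symmetric_normalmx symB realB.
have dreal := hermitian_spectral_diag_real (realsym_hermsym symB realB).
have uP : P \is unitarymx := spectral_unitarymx B.
rewrite -/P -/d in defB dreal.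
have led i : d 0 i <= toC a.
  have /complex_realP[r dE] := mxOverP dreal 0 i.
  rewrite dE lecR; apply: lea.
  rewrite -(eigenvalue_map toC) -/B; apply/eigenvalueP; exists (row i P).
    rewrite defB !mulmxA -row_mul mulmxV ?unitarymx_unit // -row_mul.
    rewrite mul1mx row_diag_mx -scalemxAl -rowE dE //.
  (* If row [i] of [P] were zero, so would be row [i] of the identity [P *m invmx P]. *)
  apply/eqP => /(congr1 (mulmx^~ (invmx P))).
  rewrite -row_mul mulmxV ?unitarymx_unit // mul0mx => /rowP/(_ i).
  by rewrite !mxE eqxx => /eqP; rewrite oner_eq0.
pose z := map_mx toC x; pose y := z *m P ^t*.
have zC : z ^t* = z^T.
  by apply/matrixP=> i j; rewrite !mxE; apply/CrealP; exact: toCreal.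
have yC : y ^t* = P *m z^T by rewrite /y trmx_mul map_mxM zC trmxCK.
have formE : toC ((x *m A *m x^T) 0 0) = \sum_i d 0 i * `|y 0 i| ^+ 2.
  transitivity ((y *m diag_mx d *m y ^t*) 0 0).
    rewrite yC /y -invmx_unitary // !mulmxA -(mulmxA z) -(mulmxA z) -defB.
    by rewrite /z /B map_trmx -!map_mxM [RHS]mxE.
  rewrite mxE; apply: eq_bigr => i _.
  by rewrite mul_mx_diag !mxE normCK mulrAC mulrC.
have normE : toC ((x *m x^T) 0 0) = \sum_i `|y 0 i| ^+ 2.
  transitivity ((y *m y ^t*) 0 0).
    rewrite yC /y -invmx_unitary // !mulmxA mulmxKV ?unitarymx_unit //.
    by rewrite /z map_trmx -!map_mxM [RHS]mxE.
  by rewrite mxE; apply: eq_bigr => i _; rewrite !mxE normCK.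
have toCM b c : toC (b * c) = toC b * toC c by exact: rmorphM.
rewrite -lecR -/toC formE toCM normE mulr_sumr.
apply: ler_sum => i _.
by rewrite ler_wpM2r ?exprn_ge0.
Qed.

End Rayleigh.

(** Cauchy-Schwarz: the double sum of the squares of [F i - F j] is nonnegative and expands to twice
    [#|A| * Q - S ^ 2]. *)
Lemma sqr_sum_le (R : realDomainType) (I : finType) (A : {set I}) (F : I -> R) :
  (\sum_(i in A) F i) ^+ 2 <= #|A|%:R * \sum_(i in A) F i ^+ 2.
Proof.
have : 0 <= \sum_(i in A) \sum_(j in A) (F i - F j) ^+ 2.
  by do 2!apply: sumr_ge0 => ? _; exact: sqr_ge0.
set S := \sum_(i in A) F i; set Q := \sum_(i in A) F i ^+ 2.
have -> : \sum_(i in A) \sum_(j in A) (F i - F j) ^+ 2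
    = \sum_(i in A) (F i ^+ 2 *+ #|A| + Q - 2 * S * F i).
  apply: eq_bigr => i _.
  under eq_bigr do rewrite sqrrB -addrA [- _ + _]addrC addrA.
  rewrite big_split big_split /= sumr_const -/Q; congr (_ + _ + _).
  by rewrite sumrN sumrMnl -mulr_sumr mulr_natl mulrnAl [S * _]mulrC.
rewrite big_split big_split /= sumrMnl sumr_const sumrN -mulr_sumr -/S -/Q.
by rewrite -mulr_natl => h; lra.
Qed.

(** * Distances in connected bipartite graphs *)

Section Distance.
Variable G : sgraph.
Hypothesis connG : connected G.
Implicit Types u v w x y : G.

Lemma dist_walk x y : walk_length (dist x y) x y.
Proof.
(* A path without repeated vertices has fewer than [#|G|] edges, so the search in [dist] succeeds
   before its default value. *)
have hasP : has (fun k => walk_length k x y) (iota 0 #|G|).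
  have /connectP[p0 p0P ->] := connG x y.
  case/shortenP: p0P => p pP Up _; apply/hasP; exists (size p).
    by rewrite mem_iota; have := max_card (mem (x :: p)); rewrite (card_uniqP Up).
  by apply/existsP; exists (in_tuple p); rewrite pP eqxx.
have:= nth_find 0%N hasP; rewrite nth_iota ?add0n //.
by move: hasP; rewrite has_find size_iota.
Qed.

Lemma dist_le_walk k x y : walk_length k x y -> (dist x y <= k)%N.
Proof.
move=> kP; rewrite leqNgt; apply/negP => lt.
have ltG : (k < #|G|)%N.
  by apply: leq_trans lt _; rewrite -[leqRHS](size_iota 0) find_size.
by have := before_find 0%N lt; rewrite nth_iota // add0n kP.
Qed.

Lemma dist0E x y : (dist x y == 0%N) = (x == y).
Proof.
apply/eqP/eqP => [d0|<-].
  have := dist_walk x y; rewrite d0 => /existsP[p].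
  by rewrite (tuple0 p) => /eqP.
apply/eqP; rewrite -leqn0; apply: dist_le_walk; apply/existsP.
by exists [tuple]; rewrite /= eqxx.
Qed.

Lemma dist1E x y : (dist x y == 1%N) = adj x y.
Proof.
apply/eqP/idP => [d1|xy].
  have := dist_walk x y; rewrite d1 => /existsP[[[|z []] //= _]].
  by rewrite andbT => /andP[xz /eqP <-].
apply/eqP; rewrite eqn_leq; apply/andP; split.
  by apply: dist_le_walk; apply/existsP; exists [tuple y]; rewrite /= xy eqxx.
by rewrite lt0n dist0E; apply: contraTneq xy => ->; rewrite adj_irr.
Qed.

Lemma dist_le_diameter x y : (dist x y <= diameter G)%N.
Proof.
apply: leq_trans (leq_bigmax x).
exact: (@leq_bigmax _ (fun y => dist x y)).
Qed.

Variable side : G -> bool.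
Hypothesis adj_side : forall x y, adj x y -> side y = ~~ side x.

Lemma odd_dist x y : odd (dist x y) = side x (+) side y.
Proof.
have /existsP[p /andP[]] := dist_walk x y; have := size_tuple p.
move: (tval p) => {p} s <- + /eqP <-.
elim: s x => [|z s IH] x /=; first by rewrite addbb.
by case/andP=> xz /IH ->; rewrite (adj_side xz); case: (side x); case: (side _).
Qed.

Hypothesis diamG : (diameter G <= 3)%N.

(** On the side of [u], all vertices are closer to [u] except the neighbours of [v] other than [u];
    on the side of [v], only the neighbours of [u] other than [v] are. The additive form avoids
    truncated subtraction. *)
Lemma closerE u v : adj u v ->
  (closer u v + deg v = #|[set w | side w == side u]| + deg u)%N.
Proof.
move=> uv.
have cardE (P : pred G) : #|[set w | P w]| = (\sum_w P w)%N.
  by rewrite -sum1_card big_mkcond; apply: eq_bigr => w _; rewrite inE; case: (P w).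
have sum_eq1 x : (\sum_w (w == x))%N = 1%N.
  by rewrite -(cardE (pred1 x)) -(cards1 x); apply: eq_card => w; rewrite !inE.
(* Adding 1 to both sides, as [w == v] and [w == u], makes the identity hold
   summand by summand. *)
apply/eqP; rewrite -(eqn_add2r 1%N) -{1}(sum_eq1 v) -(sum_eq1 u).
rewrite /closer /deg !cardE -!big_split /=; apply/eqP/eq_bigr => w _.
have := odd_dist w u; have := odd_dist w v.
have := dist_le_diameter w u; have := dist_le_diameter w v.
rewrite [adj v w]adj_sym [adj u w]adj_sym -!dist1E -!dist0E (adj_side uv).
move=> /leq_trans/(_ diamG) + /leq_trans/(_ diamG).
(* Parity alone would allow the distances 0 and 3, but at distance 0 [w] is an end of the edge and
   the other distance is 1. *)
have : ~~ ((dist w u == 0%N) && (dist w v == 3%N)).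
  apply/negP => /andP[]; rewrite dist0E => /eqP ->.
  by have := uv; rewrite -dist1E => /eqP ->.
have : ~~ ((dist w v == 0%N) && (dist w u == 3%N)).
  apply/negP => /andP[]; rewrite dist0E => /eqP ->.
  by have := uv; rewrite adj_sym -dist1E => /eqP ->.
case: (dist w u) => [|[|[|[|//]]]]; case: (dist w v) => [|[|[|[|//]]]] //=;
  by case: (side w); case: (side u).
Qed.

End Distance.

(** * Sums over edges and the Laplacian quadratic form *)

Section QuadraticForm.
Variable G : sgraph.
Implicit Types u v w x y : G.

(** Of an adjacent ordered pair and its swap, exactly one lies in [edges G]. *)
Lemma sum_adj (M : nmodType) (F : G -> G -> M) :
  \sum_x \sum_(y | adj x y) F x y =
  \sum_(p in edges G) (F p.1 p.2 + F p.2 p.1).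
Proof.
rewrite pair_big_dep /= big_split /=.
rewrite (bigID (fun p : G * G => (enum_rank p.1 < enum_rank p.2)%N)) /=.
congr (_ + _); first by apply: eq_bigl => p; rewrite inE.
rewrite (reindex_inj (can_inj (@swap_pairK G G))) /=.
apply: eq_bigl => -[x y]; rewrite inE /= -leqNgt adj_sym leq_eqVlt.
by case: eqP => //= /ord_inj/enum_rank_inj ->; rewrite adj_irr.
Qed.

Lemma sum_adjl (R : pzRingType) (f : G -> R) :
  \sum_x (deg x)%:R * f x = \sum_(p in edges G) (f p.1 + f p.2).
Proof.
rewrite -(sum_adj (fun x _ => f x)); apply: eq_bigr => x _.
rewrite sumr_const mulr_natl; congr (_ *+ _).
by rewrite /deg; apply: eq_card => y; rewrite inE.
Qed.

Lemma laplacian_form (R : comNzRingType) (f : G -> R)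
    (x := \row_i f (enum_val i)) :
  (x *m laplacian G R *m x^T) 0 0 = \sum_(p in edges G) (f p.1 - f p.2) ^+ 2.
Proof.
(* The two orientations of an edge contribute terms that add up to the squared difference. *)
transitivity (\sum_w \sum_(v | adj w v) (f w ^+ 2 - f w * f v)); last first.
  by rewrite sum_adj; apply: eq_bigr => p _; ring.
rewrite mxE (reindex _ (onW_bij _ (@enum_rank_bij G))); apply: eq_bigr => w _.
rewrite !mxE enum_rankK (reindex _ (onW_bij _ (@enum_rank_bij G))) /=.
under eq_bigr do rewrite !mxE enum_rankK (inj_eq enum_rank_inj) enum_rankK.
rewrite (bigD1 w) //= eqxx sumrB sumr_const mulrDl mulr_suml; congr (_ + _).
  rewrite /deg cardsE -mulr_natr; ring.
rewrite -sumrN [LHS]big_mkcond [RHS]big_mkcond; apply: eq_bigr => v _.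
case: eqP => [->|] /=; first by rewrite adj_irr.
by rewrite adj_sym => _; case: ifP => _; ring.
Qed.

Lemma laplacian_sym (R : nzRingType) : (laplacian G R)^T = laplacian G R.
Proof.
by apply/matrixP=> i j; rewrite !mxE eq_sym adj_sym; case: eqP => [->|].
Qed.

End QuadraticForm.

Lemma sum_edges_le (R : rcfType) (G : sgraph) (a : R) (f : G -> R) :
  (forall b, eigenvalue (laplacian G R) b -> b <= a) ->
  #|G|%:R * \sum_(p in edges G) (f p.1 - f p.2) ^+ 2 <=
  a * (#|G|%:R * \sum_x f x ^+ 2 - (\sum_x f x) ^+ 2).
Proof.
move=> lea; have [G0|Gpos] := posnP #|G|.
  rewrite G0 !mul0r big1 ?expr0n ?subrr ?mulr0 // => x _.
  by have := fintype0 x G0.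
have N0 : #|G|%:R != 0 :> R by rewrite pnatr_eq0 -lt0n.
(* Subtracting the mean [c] keeps all edge differences and lowers the squared norm by
   [(\sum_x f x) ^+ 2 / #|G|]. *)
pose c := (\sum_x f x) / #|G|%:R; pose g x := f x - c.
pose v : 'rV_#|G| := \row_i g (enum_val i).
have := rayleigh_le v (laplacian_sym G R) lea.
rewrite laplacian_form.
have -> : \sum_(p in edges G) (g p.1 - g p.2) ^+ 2 =
    \sum_(p in edges G) (f p.1 - f p.2) ^+ 2.
  by apply: eq_bigr => p _; rewrite /g; congr (_ ^+ 2); ring.
have -> : (v *m v^T) 0 0 =
    \sum_x f x ^+ 2 - (\sum_x f x) ^+ 2 / #|G|%:R.
  rewrite mxE (reindex _ (onW_bij _ (@enum_rank_bij G))) /=.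
  under eq_bigr do rewrite !mxE enum_rankK -expr2 /g sqrrB.
  rewrite big_split sumrB /= sumr_const sumrMnl -mulr_suml.
  by rewrite -[_ *+ #|G|]mulr_natr -mulr_natr /c; field.
move=> /(ler_wpM2l (ler0n R #|G|)) /le_trans; apply.
by rewrite le_eqVlt; apply/orP; left; apply/eqP; field.
Qed.

Theorem theorem3p5 (R : rcfType) (G : sgraph) (V1 V2 : {set G})
    (n m n1 n2 : nat) (lambda_max : R)
    (hn : #|G| = n) (hm : #|edges G| = m)
    (hn1 : #|V1| = n1) (hn2 : #|V2| = n2)
    (hbip : bipartition V1 V2)
    (hconn : connected G) (hdiam : diameter G = 3%N)
    (hlam : largest_eigenvalue (laplacian G R) lambda_max) :
  (mostar G)%:R <=
    Num.sqrt (m%:R) *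
    Num.sqrt (lambda_max / n%:R *
      (n1%:R * n2%:R * n%:R ^+ 2 - 4 * m%:R * n%:R ^+ 2
       + 4 * (zagreb1 G)%:R * n%:R - 4 * n1%:R ^+ 2 * n2%:R ^+ 2
       - 16 * m%:R ^+ 2 + 16 * n1%:R * n2%:R * m%:R)).
Proof.
case: hbip => V12 disV bip.
have V2E w : (w \in V2) = (w \notin V1).
  have := in_setT w; rewrite -V12 inE.
  by case: (boolP (w \in V1)) => [/(disjointFr disV) ->|_] //= ->.
have adj_side x y : adj x y -> (y \in V1) = ~~ (x \in V1).
  by move=> /bip; rewrite !V2E; case: (x \in V1); case: (y \in V1).
(* The size of the part containing [w], in the form in which [closerE] produces it. *)
pose s w : R := #|[set z | (z \in V1) == (w \in V1)]|%:R.
have s1 w : w \in V1 -> s w = n1%:R.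
  move=> wV; rewrite /s wV -hn1; congr _%:R; apply: eq_card => z.
  by rewrite inE eqb_id.
have s2 w : w \notin V1 -> s w = n2%:R.
  move=> /negbTE wV; rewrite /s wV -hn2; congr _%:R; apply: eq_card => z.
  by rewrite inE V2E eqbF_neg.
have sumS (F : R -> R) : \sum_w F (s w) = F n1%:R * n1%:R + F n2%:R * n2%:R.
  rewrite !mulr_natr (bigID (mem V1)) /= -{2}hn1 -{2}hn2 -!sumr_const.
  congr (_ + _).
    by apply: eq_bigr => w /s1 ->.
  by apply: eq_big => w; rewrite ?V2E // => /s2 ->.
have nE : n%:R = n1%:R + n2%:R :> R.
  by have := sumS (fun=> 1); rewrite sumr_const hn !mul1r.
pose D (w : G) : R := (deg w)%:R; pose f w := 2 * D w + s w.
have sumD : \sum_w D w = 2 * m%:R.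
  have := sum_adjl (fun _ : G => 1 : R).
  rewrite sumr_const hm -[RHS]mulr_natr => <-.
  by apply: eq_bigr => w _; rewrite mulr1.
(* Each edge has one end in each part, so it contributes [n1 + n2 = n]. *)
have sumDs : \sum_w D w * s w = m%:R * n%:R.
  rewrite (sum_adjl s) nE mulr_natl -hm -sumr_const; apply: eq_bigr => -[x y].
  rewrite inE /= => /andP[/adj_side + _]; case: (boolP (x \in V1)) => xV /=.
    by move=> /negbT yV; rewrite s1 // s2.
  by move=> yV; rewrite s2 // s1 // addrC.
have sumD2 : \sum_w D w ^+ 2 = (zagreb1 G)%:R.
  by rewrite natr_sum; apply: eq_bigr => w _; rewrite natrX.
have sumf : \sum_w f w = 4 * m%:R + n1%:R ^+ 2 + n2%:R ^+ 2.
  rewrite big_split /= -mulr_sumr sumD (sumS id); ring.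
have sumf2 : \sum_w f w ^+ 2 =
    4 * (zagreb1 G)%:R + 4 * (m%:R * n%:R) + n1%:R ^+ 3 + n2%:R ^+ 3.
  transitivity
    (4 * \sum_w D w ^+ 2 + 4 * (\sum_w D w * s w) + \sum_w s w ^+ 2).
    by rewrite !mulr_sumr -!big_split /=; apply: eq_bigr => w _; rewrite /f; ring.
  rewrite sumD2 sumDs (sumS (fun x => x ^+ 2)); ring.
have mostarE : (mostar G)%:R = \sum_(p in edges G) `|f p.1 - f p.2| :> R.
  rewrite natr_sum; apply: eq_bigr => -[u v]; rewrite inE /= => /andP[uv _].
  have diam3 : (diameter G <= 3)%N by rewrite hdiam.
  (* The identities for both orientations, subtracted, give the difference [f u - f v]. *)
  have /(congr1 (fun k => k%:R : R)) := closerE hconn adj_side diam3 uv.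
  have vu : adj v u by rewrite adj_sym.
  have /(congr1 (fun k => k%:R : R)) := closerE hconn adj_side diam3 vu.
  rewrite !natrD -/(s u) -/(s v) -/(D u) -/(D v) => cv cu.
  rewrite natr_absz intr_norm rmorphB /= -!pmulrn; congr `|_|.
  rewrite /f; lra.
(* On an empty graph the maximum defining the diameter would be 0. *)
have n_gt0 : (0 < n)%N.
  rewrite lt0n -hn; apply: contra_eqN hdiam => /eqP G0.
  by rewrite /diameter big_pred0 // => x; have := fintype0 x G0.
have N0 : 0 < n%:R :> R by rewrite ltr0n.
rewrite -sqrtrM ?ler0n // -[leLHS]ger0_norm ?ler0n // -sqrtr_sqr.
apply: ler_wsqrtr; rewrite mostarE.
apply: le_trans (sqr_sum_le _ _) _; rewrite hm ler_wpM2l ?ler0n //.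
under eq_bigr do rewrite real_normK ?num_real //.
have := sum_edges_le f hlam.2; rewrite hn sumf sumf2 mulrC -ler_pdivlMr //.
(* What remains is an identity, resting on [n1^2 + n2^2 = n^2 - 2 n1 n2] and [n (n1^3 + n2^3) -
   (n1^2 + n2^2)^2 = n1 n2 (n1 - n2)^2]. *)
move=> /le_trans; apply; rewrite mulrAC le_eqVlt nE; apply/orP; left.
by apply/eqP; field; rewrite -nE gt_eqF.
Qed.
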